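(* For every finite group $G$, $C_{\mathrm{char}}(G)\subseteq\operatorname{rad}(|G|)$.
   Context: For a positive integer $n$, $\operatorname{rad}(n)$ denotes the set of primes dividing $n$. Character probe: for $\chi\in\operatorname{Irr}(G)$ (irreducible complex characters), the Galois-orbit trace of $\chi$ is the integer-valued class function $$\operatorname{OrbTr}(\chi)(c)=\sum_{\psi\in\operatorname{Gal}(\overline{\mathbb{Q}}/\mathbb{Q})\cdot\chi}\psi(c),$$ the sum over the distinct characters in the Galois orbit of $\chi$, evaluated at conjugacy classes $c$ of $G$. Let $M_{\mathrm{char}}(G)$ be the $\mathbb{Z}$-span of all differences $\operatorname{OrbTr}(\chi)-\operatorname{OrbTr}(\chi')$, $\chi,\chi'\in\operatorname{Irr}(G)$, viewed as integer vectors indexed by the conjugacy classes of $G$. The character conductor is the set of primes $C_{\mathrm{char}}(G)=\{p\text{ prime}:\operatorname{rank}_{\mathbb{F}_p}(M_{\mathrm{char}}(G)\bmod p)<\operatorname{rank}_{\mathbb{Q}}M_{\mathrm{char}}(G)\}$. *)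

(* Defs.v *)
From HB Require Import structures.
From mathcomp Require Import all_boot all_order all_algebra all_fingroup.
From mathcomp Require Import all_solvable all_field all_character.
From mathcomp Require Import boolp.

Set Implicit Arguments.
Unset Strict Implicit.
Unset Printing Implicit Defensive.

Import Order.TTheory GRing.Theory Num.Theory.
Local Open Scope ring_scope.

(* algC is the field of algebraic numbers.  Every ring endomorphism of algC   *)
(* is an automorphism fixing rat (algC_autK, fmorph_eq_rat), so the type      *)
(* {rmorphism algC -> algC} is the absolute Galois group.  Distinct indices   *)
(* denote distinct irreducible characters (irr_inj).                          *)
Definition gal_orbit (gT : finGroupType) (G : {group gT}) (i : Iirr G)
    : {set Iirr G} :=
  [set j | `[< exists u : {rmorphism algC -> algC},
                 'chi_j = cfAut u 'chi_i >]].

Definition orbTr (gT : finGroupType) (G : {group gT}) (i : Iirr G) : 'CF(G) :=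
  \sum_(j in gal_orbit i) 'chi_j.

(* Num.floor only reads off the integer value: see orbTr_int and orbTr_rowE.  *)
Definition orbTr_row (gT : finGroupType) (G : {group gT}) (i : Iirr G)
    : 'rV[int]_#|classes G| :=
  \row_k Num.floor (orbTr i (repr (enum_val k))).

Definition Mchar (gT : finGroupType) (G : {group gT})
    (v : 'rV[int]_#|classes G|) : Prop :=
  exists a : Iirr G * Iirr G -> int,
    v = \sum_ij (orbTr_row ij.1 - orbTr_row ij.2) *~ a ij.

(* The largest number of elements of M with F-linearly independent images in  *)
(* F^n, that is, the dimension of the F-span of the image of M.  For a        *)
(* subgroup M of Z^n this is the rank of M when F = rat, and when F = 'F_p    *)
(* the image of M is already a subspace, namely M mod p.                      *)
Definition rank_in (F : fieldType) (n : nat) (M : 'rV[int]_n -> Prop) : nat :=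
  \max_(r < n.+1 | `[< exists B : 'M[int]_(r, n),
                         (forall i, M (row i B)) /\
                         row_free (map_mx (intr : int -> F) B) >]) r.

Definition char_conductor (gT : finGroupType) (G : {group gT}) : nat_pred :=
  [pred p | prime p &
            (rank_in 'F_p (@Mchar gT G) < rank_in rat (@Mchar gT G))%N].

Definition prime_rad (n : nat) : nat_pred := [pred p | prime p & (p %| n)%N].

Lemma gal_orbit_aut (gT : finGroupType) (G : {group gT}) (i : Iirr G)
    (u : {rmorphism algC -> algC}) j :
  (aut_Iirr u j \in gal_orbit i) = (j \in gal_orbit i).
Proof.
have [v uK vK] : exists2 v : {rmorphism algC -> algC}, cancel u v & cancel v u.
  by exists (algC_invaut u); [exact: algC_autK | exact: algC_invautK].
rewrite !inE; apply/asboolP/asboolP => -[w Dw].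
  exists (v \o w); apply/cfunP=> x; rewrite !cfunE /=.
  have := congr1 (fun phi : 'CF(G) => v (phi x)) Dw.
  by rewrite aut_IirrE !cfunE uK.
exists (u \o w); apply/cfunP=> x; rewrite aut_IirrE !cfunE /=.
by rewrite Dw cfunE.
Qed.

Lemma orbTr_fixed (gT : finGroupType) (G : {group gT}) (i : Iirr G)
    (u : {rmorphism algC -> algC}) x :
  u (orbTr i x) = orbTr i x.
Proof.
rewrite /orbTr !sum_cfunE rmorph_sum /=.
rewrite [RHS](reindex_inj (@aut_Iirr_inj _ G u)) /=.
by apply: eq_big => j => [|_]; rewrite ?gal_orbit_aut // aut_IirrE cfunE.
Qed.

Lemma orbTr_int (gT : finGroupType) (G : {group gT}) (i : Iirr G) x :
  orbTr i x \in Num.int.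
Proof.
have Ntr : orbTr i \is a character.
  by apply: rpred_sum => j _; exact: irr_char.
apply: Cint_rat_Aint; last exact: Aint_char.
have [Gx | /cfun0-> //] := boolP (x \in G).
have [Qn galQn [QnC gQnC [w _ Qn_g]]] := group_num_field_exists G.
have [a Da] := Qn_g _ _ _ Ntr x (order_dvdG Gx).
have : a \in fixedField 'Gal({:Qn} / 1)%g.
  apply/fixedFieldP; first exact: memvf.
  move=> nu _; apply: (fmorph_inj QnC).
  by have [u Du] := gQnC nu; rewrite Du Da orbTr_fixed.
rewrite (galois_fixedField galQn) => /vlineP[c Dc].
by rewrite -Da Dc alg_num_field fmorph_rat; apply/Crat_rat.
Qed.

Lemma orbTr_rowE (gT : finGroupType) (G : {group gT}) (i : Iirr G) x
    (xG : x \in G) :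
  (orbTr_row i 0 (enum_rank_in (classes1 G) (x ^: G)%g))%:~R = orbTr i x.
Proof.
rewrite mxE enum_rankK_in ?mem_classes //.
have [y Gy ->] := repr_class G x; rewrite cfunJ //.
exact/floorK/orbTr_int.
Qed.

(* Main.v *)
Require Import Defs.
From mathcomp Require Import all_boot all_order all_algebra all_fingroup.
From mathcomp Require Import all_solvable all_field all_character.
From mathcomp Require Import boolp.

Set Implicit Arguments.
Unset Strict Implicit.
Unset Printing Implicit Defensive.

Import Order.TTheory GRing.Theory Num.Theory.
Local Open Scope ring_scope.

(** Write S_i for the orbit trace of the irreducible character chi_i.  The
  lattice spanned by the differences S_i - S_j is generated by the differences
  S_i - S_0 with a fixed base orbit (rank_in_Mchar_le), and S_i depends only on
  the orbit of i.  So a family of generators that is linearly independent over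
  the rationals and realises the rational rank consists of differences
  S_k - S_0 for pairwise distinct orbits, all different from the base orbit.

  Such a family stays independent modulo every prime p not dividing the order
  of G (rank_in_Mchar_ge).  Indeed, let phi be an integral combination of the
  S_k - S_0 with coefficients c_k, all of whose values are divisible by p.
  Distinct orbits are disjoint, so the first orthogonality relation gives
  '[phi, chi_k] = c_k.  Now #|G| * '[phi, chi_k] is the sum of the
  phi(x) (chi_k(x))^*, which is p times an algebraic integer; since it is also
  the rational number #|G| c_k, it follows that p divides the integer
  #|G| c_k, hence divides c_k (dvdz_cfdot_irr).

  The rank modulo p is therefore at least the rational rank, which is the
  contrapositive of the inclusion. *)

Lemma row_free_row_inj (F : fieldType) (m n : nat) (A : 'M[F]_(m, n)) :
  row_free A -> injective (fun i => row i A).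
Proof.
move=> freeA i j; rewrite !rowE => /(row_free_inj freeA)/rowP/(_ i)/eqP.
by rewrite !mxE !eqxx /=; have [//|_] := eqVneq i j; rewrite oner_eq0.
Qed.

Lemma row_free_row_neq0 (F : fieldType) (m n : nat) (A : 'M[F]_(m, n)) i :
  row_free A -> row i A != 0.
Proof.
move=> freeA; apply/eqP; rewrite rowE -(mul0mx _ A).
by move=> /(row_free_inj freeA)/rowP/(_ i)/eqP; rewrite !mxE !eqxx oner_eq0.
Qed.

Lemma gal_orbit_refl (gT : finGroupType) (G : {group gT}) (i : Iirr G) :
  i \in gal_orbit i.
Proof.
by rewrite inE; apply/asboolP; exists idfun; apply/cfunP=> x; rewrite cfunE.
Qed.

(** Orbits partition the irreducible characters because field endomorphisms of
  algC compose and are invertible. *)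
Lemma gal_orbit_eq (gT : finGroupType) (G : {group gT}) (i j : Iirr G) :
  j \in gal_orbit i -> gal_orbit j = gal_orbit i.
Proof.
rewrite inE => /asboolP[u Du].
have sub k : k \in gal_orbit j -> k \in gal_orbit i.
  rewrite !inE => /asboolP[w Dw]; apply/asboolP; exists (w \o u).
  by apply/cfunP=> x; rewrite Dw Du !cfunE.
apply/setP=> k; apply/idP/idP; first exact: sub.
rewrite !inE => /asboolP[w Dw]; apply/asboolP; exists (w \o algC_invaut u).
by apply/cfunP=> x; rewrite Dw Du !cfunE /= algC_autK.
Qed.

Lemma cfdot_orbTr_irr (gT : finGroupType) (G : {group gT}) (i j : Iirr G) :
  '[orbTr i, 'chi_j] = (j \in gal_orbit i)%:R.
Proof.
rewrite /orbTr cfdot_suml; under eq_bigr do rewrite cfdot_irr.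
have [iO | iNO] := boolP (j \in gal_orbit i).
  rewrite (bigD1 j) //= eqxx big1 ?addr0 // => k /andP[_ /negPf->] //.
by rewrite big1 // => k kO; case: eqP => // Dk; rewrite -Dk kO in iNO.
Qed.

(** Coefficients on irreducible characters can be recovered modulo p from the
  values modulo p: inverting the character table only divides by #|G|, and
  character values are algebraic integers, among which divisibility of rational
  integers by p means the same as in the ring of integers. *)
Lemma dvdz_cfdot_irr (gT : finGroupType) (G : {group gT}) (phi : 'CF(G))
    (i : Iirr G) (p : nat) (c : int) (m : gT -> int) :
    coprime p #|G| -> (forall x, x \in G -> phi x = p%:R * (m x)%:~R) ->
  '[phi, 'chi_i] = c%:~R -> (p %| c)%Z.
Proof.
move=> co_p Dphi Dc.
(* If p = 0, then phi vanishes on G and so c = 0. *)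
have [p0 | p_gt0] := posnP p.
  move: Dc; rewrite cfdotE big1 => [|x Gx]; last by rewrite Dphi // p0 !mul0r.
  by rewrite mulr0 => /esym/eqP; rewrite intr_eq0 p0 => /eqP->.
have nzp : p%:R != 0 :> algC by rewrite pnatr_eq0 -lt0n.
pose z := \sum_(x in G) (m x)%:~R * ('chi_i x)^*.
have Dz : #|G|%:R * c%:~R = p%:R * z.
  rewrite -Dc cfdotE mulrA divff ?neq0CG // mul1r mulr_sumr.
  by apply: eq_bigr => x Gx; rewrite Dphi // mulrA.
have Az : z \in Aint.
  apply: rpred_sum => x _; rewrite rpredM ?Aint_aut ?Aint_irr //.
  exact/Aint_Cint/intr_int.
have /Cint_rat_Aint/(_ Az)/intrP[n Dn] : z \in Crat.
  rewrite -[z](mulKf nzp) -Dz.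
  by rewrite rpredM ?rpredV ?rpredM ?rpred_nat ?rpred_int.
have: (p %| #|G|%:Z * c)%Z.
  apply/dvdzP; exists n; apply: (@intr_inj algC).
  by rewrite !rmorphM /= -!pmulrn Dz Dn mulrC.
by rewrite Gauss_dvdzr.
Qed.

(** The trivial character, of index 0, serves as the base point: the rows
  generate the whole lattice of differences. *)
Definition orbDiff_mx (gT : finGroupType) (G : {group gT})
    : 'M[int]_(#|Iirr G|, #|classes G|) :=
  \matrix_i (orbTr_row (enum_val i) - orbTr_row 0).

Lemma Mchar_orbDiff (gT : finGroupType) (G : {group gT}) (i : Iirr G) :
  Mchar (orbTr_row i - orbTr_row 0).
Proof.
exists (fun ij => (ij == (i, 0))%:R); rewrite (bigD1 (i, 0)) //= eqxx mulr1z.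
by rewrite big1 ?addr0 // => ij /negPf->; rewrite mulr0z.
Qed.

Lemma rank_in_Mchar_le (gT : finGroupType) (G : {group gT}) (F : fieldType) :
  (rank_in F (@Mchar _ G) <= \rank (map_mx (intr : int -> F) (orbDiff_mx G)))%N.
Proof.
apply/bigmax_leqP => r /asboolP[B [MB freeB]].
rewrite -(eqP freeB); apply/mxrankS/row_subP => k.
have [a Da] := MB k; rewrite -map_row Da raddf_sum.
apply: summx_sub => -[i j] _ /=; rewrite raddfMz -scaler_int scalemx_sub //.
have D l : map_mx (intr : int -> F) (orbTr_row l - orbTr_row 0)
           = row (enum_rank l) (map_mx intr (orbDiff_mx G)).
  by rewrite -map_row rowK enum_rankK.
have -> : orbTr_row i - orbTr_row j
        = (orbTr_row i - orbTr_row 0) - (orbTr_row j - orbTr_row 0).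
  by rewrite opprB addrA subrK.
by rewrite raddfB /= addmx_sub ?eqmx_opp // D row_sub.
Qed.

(** A difference of two orbit traces has a nonzero coefficient only on these
  two orbits.  As the orbits of the f k and of 0 are pairwise distinct, pairing
  a combination of the S_(f k) - S_0 with chi_(f k0) isolates the coefficient
  of index k0; by dvdz_cfdot_irr this works modulo p as well. *)
Lemma rank_in_Mchar_ge (gT : finGroupType) (G : {group gT}) (p r : nat)
    (f : 'I_r -> Iirr G) :
    prime p -> coprime p #|G| ->
    injective (fun k => gal_orbit (f k)) ->
    (forall k, gal_orbit (f k) != gal_orbit 0) ->
  (r <= rank_in 'F_p (@Mchar _ G))%N.
Proof.
move=> p_pr co_p injf f_neq0.
pose B : 'M[int]_(r, #|classes G|) :=
  \matrix_k (orbTr_row (f k) - orbTr_row 0).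
have freeB : row_free (map_mx (intr : int -> 'F_p) B).
  apply/inj_row_free => v vB0; apply/rowP=> k0; rewrite mxE.
  (* Lift the relation v modulo p to integer coefficients c. *)
  pose c k : int := (v 0 k : nat)%:Z.
  have Dc k : (c k)%:~R = v 0 k by rewrite -pmulrn natr_Zp.
  have pF : p \in [pchar 'F_p] by rewrite pchar_Fp.
  pose phi := \sum_k (orbTr (f k) - orbTr 0) *~ c k.
  pose w : 'rV[int]_#|classes G| := \sum_k c k *: row k B.
  have pw j : (p %| w 0%R j)%Z.
    rewrite (dvdz_pcharf pF) -[X in _ == X](_ : (v *m map_mx intr B) 0 j = 0).
      rewrite mxE summxE rmorph_sum; apply/eqP/eq_bigr => k _.
      by rewrite !mxE rmorphM /= Dc.
    by rewrite vB0 mxE.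
  pose m x := (w 0%R (enum_rank_in (classes1 G) (x ^: G)%g) %/ p)%Z.
  have Dphi x : x \in G -> phi x = p%:R * (m x)%:~R.
    move=> Gx; rewrite [p%:R]pmulrn -intrM mulrC divzK //.
    rewrite summxE rmorph_sum sum_cfunE; apply: eq_bigr => k _ /=.
    rewrite rowK mxE [in RHS]mxE [in X in _ = (_ * (_ + X))%:~R]mxE.
    rewrite rmorphM rmorphB /= !orbTr_rowE //.
    by rewrite -scaler_int !cfunE.
  have phi_k0 : '[phi, 'chi_(f k0)] = (c k0)%:~R.
    have /negPf k0'0 : f k0 \notin gal_orbit 0.
      by apply: contra (f_neq0 k0) => /gal_orbit_eq->.
    rewrite cfdot_suml (bigD1 k0) //= big1 => [|k k'0].
      rewrite -scaler_int cfdotZl cfdotBl !cfdot_orbTr_irr gal_orbit_refl k0'0.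
      by rewrite subr0 mulr1 addr0.
    rewrite -scaler_int cfdotZl cfdotBl !cfdot_orbTr_irr k0'0.
    have /negPf-> : f k0 \notin gal_orbit (f k).
      by apply: contra k'0 => /gal_orbit_eq/injf->.
    by rewrite subrr mulr0.
  have := dvdz_cfdot_irr co_p Dphi phi_k0.
  by rewrite (dvdz_pcharf pF) Dc => /eqP.
have r_le : (r < #|classes G|.+1)%N.
  by rewrite ltnS -(eqP freeB) rank_leq_col.
apply: (@leq_bigmax_cond _ _ (fun r : 'I__ => r : nat) (Ordinal r_le)).
by apply/asboolP; exists B; split=> // k; rewrite rowK; apply: Mchar_orbDiff.
Qed.

Theorem corollary9p4 (gT : finGroupType) (G : {group gT}) :
  {subset char_conductor G <= prime_rad #|G|}.
Proof.
move=> p; rewrite !inE => /andP[p_pr]; rewrite p_pr /= ltnNge.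
apply: contraR => p'G; have co_p : coprime p #|G| by rewrite prime_coprime.
apply: leq_trans (rank_in_Mchar_le G rat) _.
(* The f k index rows of A that form a basis of its rational row space. *)
set A := map_mx _ _; pose f k := enum_val (maxrankfun A k).
have freeA := maxrowsub_free A.
have rowA k : row k (rowsub (maxrankfun A) A)
    = map_mx intr (orbTr_row (f k) - orbTr_row 0).
  by rewrite row_rowsub -map_row rowK.
have orbTr_row_eq i j : gal_orbit i = gal_orbit j :> {set Iirr G} ->
    orbTr_row i = orbTr_row j.
  by move=> eqO; rewrite /orbTr_row /orbTr eqO.
apply: (@rank_in_Mchar_ge _ G p _ f) => // [k l /orbTr_row_eq eq_kl | k].
  by apply: (row_free_row_inj freeA); rewrite !rowA eq_kl.
apply/eqP => /orbTr_row_eq eq_k0; have /eqP[] := row_free_row_neq0 k freeA.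
by rewrite rowA eq_k0 subrr map_mx0.
Qed.
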